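(* For every integer $r\ge 3$, $\mathcal{PD}^{TJ}(K^{2,3}(K_r\circ K_1))$ is isomorphic to the star $K_{1,r}$.
   Context: Graphs are finite and simple. $K_r\circ K_1$ is the graph obtained from the complete graph $K_r$ by adding one new leaf adjacent to each vertex of $K_r$. For a connected graph $G$, $K^{2,3}(G)$ is the graph obtained from $G$ by deleting each edge $uv$ of $G$ and adding, for each deleted edge $uv$, three new vertices of degree 2, each adjacent to exactly $u$ and $v$. For a graph $G$ and a non-empty $S\subseteq V(G)$ define $P^0[S]=S$, $P^1[S]=N[S]$ (the union of the closed neighborhoods of vertices of $S$), and for $i\ge 2$, $P^i[S]=P^{i-1}[S]\cup\{u: N_G(v)\setminus P^{i-1}[S]=\{u\}\text{ for some }v\in P^{i-1}[S]\}$. $S$ is a power dominating set if $P^t[S]=V(G)$ for some $t$; it is minimum if it has the smallest cardinality among power dominating sets. The token jumping (TJ) reconfiguration graph $\mathcal{PD}^{TJ}(G)$ has as vertices all minimum power dominating sets of $G$, with $S$ and $S'$ adjacent if and only if $S$ is obtained from $S'$ by exchanging a single vertex, i.e. $|S\setminus S'|=|S'\setminus S|=1$. *)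

(* Defs.v *)
From mathcomp Require Import all_boot.
From mathcomp Require Import boolp.

Set Implicit Arguments.
Unset Strict Implicit.
Unset Printing Implicit Defensive.

Record sgraph := SGraph {
  vertex :> finType;
  adj : rel vertex;
  adj_sym : symmetric adj;
  adj_irrefl : irreflexive adj }.

Definition isomorphic (G H : sgraph) : Prop :=
  exists2 f : G -> H, bijective f & forall x y, adj (f x) (f y) = adj x y.

Definition complete_adj r : rel 'I_r := fun i j => i != j.

Lemma complete_sym r : symmetric (@complete_adj r).
Proof. by move=> i j; rewrite /complete_adj eq_sym. Qed.

Lemma complete_irrefl r : irreflexive (@complete_adj r).
Proof. by move=> i; rewrite /complete_adj eqxx. Qed.

Definition complete_graph r : sgraph :=
  SGraph (@complete_sym r) (@complete_irrefl r).

Definition complete_bipartite_adj m n : rel ('I_m + 'I_n) := fun x y =>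
  match x, y with
  | inl _, inr _ | inr _, inl _ => true
  | _, _ => false
  end.

Lemma complete_bipartite_sym m n : symmetric (@complete_bipartite_adj m n).
Proof. by case=> ? []. Qed.

Lemma complete_bipartite_irrefl m n :
  irreflexive (@complete_bipartite_adj m n).
Proof. by case. Qed.

Definition complete_bipartite m n : sgraph :=
  SGraph (@complete_bipartite_sym m n) (@complete_bipartite_irrefl m n).

(* The corona G o K_1: [inl u] is the vertex u of G and [inr u] is the leaf   *)
(* attached to u.                                                             *)
Definition corona1_adj (G : sgraph) : rel (G + G) := fun x y =>
  match x, y with
  | inl u, inl v => adj u v
  | inl u, inr v | inr u, inl v => u == v
  | inr _, inr _ => false
  end.

Lemma corona1_sym (G : sgraph) : symmetric (@corona1_adj G).
Proof. by case=> u [] v //=; exact: adj_sym. Qed.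

Lemma corona1_irrefl (G : sgraph) : irreflexive (@corona1_adj G).
Proof. by case=> u //=; exact: adj_irrefl. Qed.

Definition corona1 (G : sgraph) : sgraph :=
  SGraph (@corona1_sym G) (@corona1_irrefl G).

Definition edges (G : sgraph) : {set {set G}} :=
  [set A | [exists u : G, exists v : G, adj u v && (A == [set u; v])]].

(* K^{2,3}(G): [inl u] is the vertex u of G, and the three vertices           *)
(* [inr (A, k)], k < 3, replace the edge A.                                   *)
Definition K23_adj (G : sgraph) :
    rel (G + {A : {set G} | A \in edges G} * 'I_3) := fun x y =>
  match x, y with
  | inl u, inr (A, _) | inr (A, _), inl u => u \in val A
  | _, _ => false
  end.

Lemma K23_sym (G : sgraph) : symmetric (@K23_adj G).
Proof. by case=> [u|[A k]] [v|[B l]]. Qed.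

Lemma K23_irrefl (G : sgraph) : irreflexive (@K23_adj G).
Proof. by case=> [u|[A k]]. Qed.

Definition K23 (G : sgraph) : sgraph := SGraph (@K23_sym G) (@K23_irrefl G).

Section PowerDomination.

Variable G : sgraph.

Definition nbh (v : G) : {set G} := [set u | adj v u].

Definition closed_nbhs (S : {set G}) : {set G} := \bigcup_(v in S) (v |: nbh v).

Fixpoint observed (S : {set G}) (i : nat) : {set G} :=
  match i with
  | 0 => S
  | 1 => closed_nbhs S
  | j.+1 => observed S j :|:
      [set u | [exists v in observed S j, nbh v :\: observed S j == [set u]]]
  end.

Definition power_dominating (S : {set G}) : Prop :=
  S != set0 /\ exists t, observed S t = [set: G].

Definition min_power_dominating (S : {set G}) : Prop :=
  power_dominating S /\ forall S', power_dominating S' -> #|S| <= #|S'|.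

Definition TJ_adj : rel {S : {set G} | `[< min_power_dominating S >]} :=
  fun S S' => (#|val S :\: val S'| == 1) && (#|val S' :\: val S| == 1).

Lemma TJ_sym : symmetric TJ_adj.
Proof. by move=> S S'; rewrite /TJ_adj andbC. Qed.

Lemma TJ_irrefl : irreflexive TJ_adj.
Proof. by move=> S; rewrite /TJ_adj setDv cards0. Qed.

Definition PD_TJ : sgraph := SGraph TJ_sym TJ_irrefl.

End PowerDomination.

(* Main.v *)
Require Import Defs.
From mathcomp Require Import all_boot.
From mathcomp Require Import boolp.

(** In [K23 G] the three vertices replacing an edge [uv] have the same
    neighbourhood [{u, v}].  Two such twins cannot be told apart by the forcing
    rule, so a power dominating set that avoids both [u] and [v] must contain
    at least two of the three twins ([edge_hit]).  Conversely, if a vertex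
    cover of [G] is chosen, all subdivision vertices are observed after the
    domination step, and each of them then forces its possibly missing end
    ([vertex_cover_power_dominating]).

    Let [G] be [K_r o K_1], with clique vertices a_i and leaves b_i.  The r
    pendant edges give r disjoint blocks, formed by a_i, b_i and the twins that
    replace a_i b_i, and a power dominating set meets each of them.  Since the
    a_i form a vertex cover, the minimum is r.  A power dominating set of size
    r has exactly one vertex in each block and none elsewhere; this vertex is
    a_i or b_i, because otherwise two twins would lie in the block.  If b_i and
    b_j were both chosen, the edge a_i a_j would have neither a chosen end nor
    a chosen twin.  Hence the minimum sets are {a_1, ..., a_r} and the r sets
    obtained from it by exchanging one a_i for b_i, all of which are vertex
    covers ([min_power_dominatingP]).  The first set is one token jump away from
    each of the others, which differ pairwise in two tokens: a star. *)

Set Implicit Arguments.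
Unset Strict Implicit.
Unset Printing Implicit Defensive.

(** The forcing rule never observes either of two unobserved vertices with equal
    neighbourhoods: whoever sees one of them sees the other as well.  So they
    have to be observed in the domination step. *)
Lemma twins_hit (G : sgraph) (S : {set G}) (x y : G) :
  x != y -> nbh x = nbh y -> power_dominating S ->
  [|| x \in S, y \in S | [exists z in S, adj x z]].
Proof.
move=> neq_xy nbh_xy [_ [t St]]; apply: contraT.
rewrite !negb_or => /and3P[xS yS nS].
have adj_xy z : adj z x = adj z y.
  by have /setP/(_ z) := nbh_xy; rewrite !inE ![adj z _]adj_sym.
have not_adj z : z \in S -> adj z x = false.
  move=> zS; apply/negP => zx; case/negP: nS.
  by apply/existsP; exists z; rewrite zS adj_sym.
have unobserved i : x \notin observed S i /\ y \notin observed S i.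
  elim: i => [//|[_|i [IHx IHy]]].
    split; apply/negP => /bigcupP[z zS]; rewrite !inE.
      by rewrite not_adj // orbF => /eqP xz; rewrite xz zS in xS.
    by rewrite -adj_xy not_adj // orbF => /eqP yz; rewrite yz zS in yS.
  rewrite -[observed S i.+2]/(observed S i.+1 :|:
    [set u | [exists v in observed S i.+1,
               nbh v :\: observed S i.+1 == [set u]]]).
  have noforce v : nbh v :\: observed S i.+1 <> [set x] /\
                   nbh v :\: observed S i.+1 <> [set y].
    split=> /setP E; have := E x; have := E y;
      rewrite !in_setD !in_set1 IHx IHy !in_set -adj_xy /= => ->;
      by rewrite !eqxx ?[y == x]eq_sym (negPf neq_xy).
  by split; rewrite in_setU negb_or ?IHx ?IHy inE /=;
    apply/negP => /existsP[v /andP[_ /eqP]]; case: (noforce v).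
by case: (unobserved t); rewrite St inE.
Qed.

Lemma edge_in (G : sgraph) (u v : G) : adj u v -> [set u; v] \in edges G.
Proof.
by move=> uv; rewrite inE; apply/existsP; exists u; apply/existsP; exists v;
  rewrite uv eqxx.
Qed.

Lemma adj_edge (G : sgraph) (A : {set G}) (u v : G) :
  A \in edges G -> u \in A -> v \in A -> u != v -> adj u v.
Proof.
rewrite inE => /existsP[x /existsP[y /andP[xy /eqP->]]]; rewrite !inE.
by do 2![case/orP=> /eqP->]; rewrite ?eqxx // adj_sym.
Qed.

Definition twin (G : sgraph) (u v : G) (uv : adj u v) (k : 'I_3) : K23 G :=
  inr (exist (fun A => A \in edges G) _ (edge_in uv), k).

(** Among any two of the three twins one is chosen when neither end of the edge
    is, which leaves out at most one of the three. *)
Lemma edge_hit (G : sgraph) (S : {set K23 G}) (u v : G) (uv : adj u v) :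
    power_dominating S ->
  [\/ inl u \in S, inl v \in S |
      exists k l, [/\ k != l, twin uv k \in S & twin uv l \in S]].
Proof.
move=> pdS.
case: (boolP (inl u \in S)) => uS; first by constructor 1.
case: (boolP (inl v \in S)) => vS; first by constructor 2.
have hit (k l : 'I_3) : k != l -> (twin uv k \in S) || (twin uv l \in S).
  move=> kl; have neq : twin uv k != twin uv l.
    by apply: contraNneq kl => -[->].
  have nbhE : nbh (twin uv k) = nbh (twin uv l).
    by apply/setP => -[w|[B m]]; rewrite !inE.
  have /or3P[->//|->|/existsP[[w|[B m]] /andP[wS]]] := twins_hit neq nbhE pdS.
  - by rewrite orbT.
  - by rewrite /= !inE => /orP[] /eqP E; rewrite E in wS;
      rewrite wS in uS vS.
  - by [].
constructor 3; pose i0 : 'I_3 := inord 0; pose i1 : 'I_3 := inord 1.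
pose i2 : 'I_3 := inord 2.
have n01 : i0 != i1 by rewrite -val_eqE /= !inordK.
have n02 : i0 != i2 by rewrite -val_eqE /= !inordK.
have n12 : i1 != i2 by rewrite -val_eqE /= !inordK.
case: (boolP (twin uv i0 \in S)) => S0.
  by case/orP: (hit _ _ n12) => Sk; [exists i0, i1 | exists i0, i2].
exists i1, i2; have := hit _ _ n01; have := hit _ _ n02.
by rewrite (negPf S0).
Qed.

(** Two steps suffice: the cover dominates every subdivision vertex, and a
    vertex [u] outside the cover has its neighbour [v] inside, so a twin of
    [uv] forces [u]. *)
Lemma vertex_cover_power_dominating (G : sgraph) (C : {set G}) :
    C != set0 -> (forall u : G, exists v, adj u v) ->
    (forall u v : G, adj u v -> (u \in C) || (v \in C)) ->
  power_dominating [set inl u | u in C] (G := K23 G).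
Proof.
move=> C0 noiso cover; split.
  by case/set0Pn: C0 => u uC; apply/set0Pn; exists (inl u); apply: imset_f.
set S : {set K23 G} := [set _ | _ in C]; exists 2.
have sub_obs (A : {A | A \in edges G}) k :
    (inr (A, k) : K23 G) \in observed S 1.
  have : val A \in edges G := valP A.
  rewrite inE => /existsP[u /existsP[v /andP[uv /eqP Auv]]].
  apply/bigcupP; case/orP: (cover _ _ uv) => wC;
    [exists (inl u) | exists (inl v)];
    by rewrite ?imset_f // !inE /= Auv !inE eqxx ?orbT.
have C_obs u : u \in C -> (inl u : K23 G) \in observed S 1.
  move=> uC; apply/bigcupP; exists (inl u); first exact: imset_f.
  by rewrite !inE eqxx.
apply/setP => x; rewrite [RHS]inE.
rewrite -[observed S 2]/(observed S 1 :|: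
  [set u | [exists v in observed S 1, nbh v :\: observed S 1 == [set u]]]).
rewrite in_setU; case: (boolP (x \in observed S 1)) => //= xS.
case: x xS => [u uS|[A k]]; last by rewrite sub_obs.
have [v uv] := noiso u.
(* As [u] is unobserved, [v] is chosen; so a twin of [uv] is observed and [u]
   is its only unobserved neighbour. *)
have vC : v \in C.
  by case/orP: (cover _ _ uv) => // /C_obs; rewrite (negPf uS).
rewrite inE; apply/existsP.
exists (twin uv ord0); rewrite sub_obs.
apply/eqP/setP => -[w|[B l]]; rewrite in_setD in_set1; last first.
  by rewrite sub_obs.
rewrite inE /= !inE (inj_eq inl_inj).
have [->|wu] := eqVneq w u; first by rewrite uS.
by have [->|] := eqVneq w v; rewrite ?andbF // C_obs.
Qed.

Section CoronaOfComplete.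

Variable r : nat.

Local Notation H := (corona1 (complete_graph r)).

(** These are the minimum power dominating sets: [None] gives the centre
    [{a_1, ..., a_r}] of the star, and [Some i] the end where [a_i] has been
    exchanged for [b_i]. *)
Definition swapped_clique (o : option 'I_r) : {set H} :=
  [set x | match x with inl k => o != Some k | inr k => o == Some k end].

Definition swapped_tokens (o : option 'I_r) : {set K23 H} :=
  [set inl x | x in swapped_clique o].

Lemma swapped_tokensE o : swapped_tokens o =
  [set inl (if o == Some i then inr i else inl i) | i in 'I_r].
Proof.
apply/setP => z; apply/imsetP/imsetP => [[[k|k]]|[k _ ->]]; rewrite ?inE.
- by move=> ok ->; exists k => //; rewrite (negPf ok).
- by move=> ok ->; exists k => //; rewrite ok.
- by exists (if o == Some k then inr k else inl k) => //;
    case: ifP; rewrite inE => ->.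
Qed.

Lemma card_swapped_tokens o : #|swapped_tokens o| = r.
Proof.
rewrite swapped_tokensE card_imset ?card_ord // => i j.
by do 2![case: ifP => _] => -[].
Qed.

Lemma swapped_tokens_power_dominating o :
  0 < r -> power_dominating (swapped_tokens o).
Proof.
move=> r_gt0; apply: vertex_cover_power_dominating.
- apply/set0Pn; case: o => [i|]; first by exists (inr i); rewrite inE.
  by exists (inl (Ordinal r_gt0)); rewrite inE.
- by case=> i; [exists (inr i) | exists (inl i)] => /=; exact: eqxx.
- case=> i [] j //=; rewrite !inE.
  + case: o => [k|] //; rewrite !(inj_eq Some_inj) /complete_adj.
    by case: (eqVneq k i) => // -> ->.
  + by move/eqP->; rewrite orNb.
  + by move/eqP->; rewrite orbN.
Qed.

(** The leaf [b_i] lies only on the pendant edge at [a_i], so membership of [b_i]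
    in [A] singles out the twins of that edge. *)
Definition in_block (i : 'I_r) (z : K23 H) : bool :=
  match z with
  | inl (inl j) | inl (inr j) => j == i
  | inr (A, _) => inr i \in val A
  end.

Lemma in_block_inj i j z : in_block i z -> in_block j z -> i = j.
Proof.
case: z => [[k|k]|[A k]] /=; [by do 2!move/eqP=> <- | by do 2!move/eqP=> <- |].
move=> iA jA; apply/eqP; apply: contraT => ij.
by have := adj_edge (valP A) iA jA; rewrite (inj_eq inr_inj) => /(_ ij).
Qed.

Lemma adj_pendant i : adj (inl i : H) (inr i).
Proof. exact: eqxx. Qed.

Lemma block_hit (S : {set K23 H}) i :
  power_dominating S -> exists2 z, z \in S & in_block i z.
Proof.
move/(edge_hit (adj_pendant i)) => [zS|zS|[k [_ [_ zS _]]]];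
  by eexists; [exact: zS|]; rewrite /= ?inE eqxx ?orbT.
Qed.

Lemma power_dominating_transversal (S : {set K23 H}) :
    power_dominating S ->
  exists f : 'I_r -> K23 H,
    [/\ injective f, forall i, in_block i (f i) & f @: 'I_r \subset S].
Proof.
move=> pdS.
have /fin_all_exists[f fP] : forall i, exists z, z \in S /\ in_block i z.
  by move=> i; case: (block_hit i pdS) => z; exists z.
exists f; split=> [i j eq_f|i|].
- by apply: (@in_block_inj i j (f i)); [|rewrite eq_f]; apply: (fP _).2.
- by case: (fP i).
- by apply/subsetP => _ /imsetP[i _ ->]; case: (fP i).
Qed.

Lemma power_dominating_card (S : {set K23 H}) :
  power_dominating S -> r <= #|S|.
Proof.
case/power_dominating_transversal => f [f_inj _ /subset_leq_card].
by rewrite card_imset ?card_ord.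
Qed.

(** A set of size [r] consists of one vertex per block.  The pendant edges then
    exclude twins, and the edges [a_i a_j] exclude a second leaf. *)
Lemma small_power_dominating (S : {set K23 H}) :
  power_dominating S -> #|S| <= r -> exists o, S = swapped_tokens o.
Proof.
move=> pdS leSr.
have [f [f_inj f_block fS]] := power_dominating_transversal pdS.
have {fS leSr} defS : S = f @: 'I_r.
  by apply/eqP; rewrite eq_sym eqEcard fS card_imset ?card_ord.
have S_block i z : z \in S -> in_block i z -> z = f i.
  rewrite defS => /imsetP[j _ ->] /in_block_inj/(_ (f_block j)).
  by move->.
have f_edge i : f i = inl (inl i) \/ f i = inl (inr i).
  have [zS|zS|[k [l [kl kS lS]]]] := edge_hit (adj_pendant i) pdS.
  - by left; rewrite -(S_block i _ zS) //=.
  - by right; rewrite -(S_block i _ zS) //=.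
  - (* Two chosen twins would be two chosen vertices of the same block. *)
    have := S_block i _ kS; rewrite -(S_block i _ lS) /= ?inE ?eqxx ?orbT //.
    by case/(_ isT) => eq_kl; rewrite eq_kl eqxx in kl.
have one_leaf i j : f i = inl (inr i) -> f j = inl (inr j) -> i = j.
  move=> fi fj; apply/eqP; apply: contraT => ij.
  have aij : adj (inl i : H) (inl j) by [].
  have [zS|zS|[k [_ [_ zS _]]]] := edge_hit aij pdS.
  - by have := S_block i _ zS; rewrite /= eqxx fi => /(_ isT).
  - by have := S_block j _ zS; rewrite /= eqxx fj => /(_ isT).
  - by move: zS; rewrite defS => /imsetP[m _]; case: (f_edge m) => ->.
exists [pick i | f i == inl (inr i)]; rewrite defS swapped_tokensE.
apply: eq_imset => i; case: pickP => [j /eqP fj|nof].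
  rewrite (inj_eq Some_inj); have [<-//|ji] := eqVneq j i.
  by case: (f_edge i) => // fi; rewrite (one_leaf _ _ fj fi) eqxx in ji.
by case: (f_edge i) => // fi; have := nof i; rewrite fi eqxx.
Qed.

Lemma min_power_dominatingP (S : {set K23 H}) : 0 < r ->
  min_power_dominating S <-> exists o, S = swapped_tokens o.
Proof.
move=> r_gt0; split=> [[pdS minS]|[o ->]].
  apply: small_power_dominating => //.
  by have := minS _ (swapped_tokens_power_dominating None r_gt0);
    rewrite card_swapped_tokens.
split=> [|S' /power_dominating_card]; last by rewrite card_swapped_tokens.
exact: swapped_tokens_power_dominating.
Qed.

Definition swapped_leaf (S : {set K23 H}) : option 'I_r :=
  [pick i | inl (inr i) \in S].

Lemma mem_swapped_tokens o x :
  (inl x \in swapped_tokens o) = (x \in swapped_clique o).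
Proof. by rewrite mem_imset //; exact: inl_inj. Qed.

Lemma swapped_tokensK : cancel swapped_tokens swapped_leaf.
Proof.
have memE o i : (inl (inr i) \in swapped_tokens o) = (o == Some i).
  by rewrite mem_swapped_tokens inE.
move=> o; rewrite /swapped_leaf; case: pickP => [i|noi].
  by rewrite memE => /eqP.
by case: o noi => // i /(_ i); rewrite memE eqxx.
Qed.

Lemma card_swapped_tokensD o o' :
  #|swapped_tokens o :\: swapped_tokens o'|
  = #|swapped_clique o :\: swapped_clique o'|.
Proof.
rewrite -[RHS](card_imset _ (@inl_inj H ({A | A \in edges H} * 'I_3))).
apply: eq_card => z; rewrite in_setD; apply/andP/imsetP => [[]|[x]].
  move=> z' /imsetP[x xo defz]; exists x => //.
  by rewrite in_setD xo andbT -mem_swapped_tokens -defz.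
by rewrite in_setD => /andP[xo' xo] ->; rewrite !mem_swapped_tokens.
Qed.

(** Going back from [o] to the clique loses [b_i], going from the clique to
    [o'] loses the replaced [a_j]; between two different leaves both happen, so
    two tokens have to move. *)
Lemma card_swapped_cliqueD o o' :
  #|swapped_clique o :\: swapped_clique o'| =
    if o == o' then 0 else (o != None) + (o' != None).
Proof.
have [->|] := eqVneq o o'; first by rewrite setDv cards0.
have someE (i j : 'I_r) : (Some i == Some j) = (i == j) by [].
case: o o' => [i|] [j|] //= ij.
- have -> : swapped_clique (Some i) :\: swapped_clique (Some j)
            = [set inr i; inl j].
    rewrite someE in ij; apply/setP => -[k|k];
      rewrite in_setD in_set2 !in_set !someE ?negbK.
      rewrite (inj_eq inl_inj) [k == j]eq_sym /=.
      by case: (eqVneq j k) => //= <-.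
    rewrite (inj_eq inr_inj) orbF [k == i]eq_sym andbC.
    by case: (eqVneq i k) => //= <-; rewrite eq_sym.
  by rewrite cards2.
- have -> : swapped_clique (Some i) :\: swapped_clique None = [set inr i].
    apply/setP => -[k|k]; rewrite in_setD in_set1 !in_set //=.
    by rewrite someE (inj_eq inr_inj) eq_sym.
  by rewrite cards1.
- have -> : swapped_clique None :\: swapped_clique (Some j) = [set inl j].
    apply/setP => -[k|k]; rewrite in_setD in_set1 !in_set ?andbF //=.
    by rewrite negbK andbT someE (inj_eq inl_inj) eq_sym.
  by rewrite cards1.
Qed.

End CoronaOfComplete.

Theorem proposition5p7 (r : nat) (hr : 3 <= r) :
  isomorphic (PD_TJ (K23 (corona1 (complete_graph r)))) (complete_bipartite 1 r).
Proof.
have minP S := @min_power_dominatingP r S (ltn_trans (isT : 0 < 2) hr).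
have min_tokens o : `[< min_power_dominating (@swapped_tokens r o) >].
  by apply/asboolP/minP; exists o.
pose P := PD_TJ (K23 (corona1 (complete_graph r))).
pose star_tokens (x : complete_bipartite 1 r) : P :=
  exist (fun S => `[< min_power_dominating S >]) _
    (min_tokens (if x is inr i then Some i else None)).
pose tokens_star (S : P) : complete_bipartite 1 r :=
  if swapped_leaf (val S) is Some i then inr i else inl ord0.
have star_tokensK : cancel star_tokens tokens_star.
  by case=> i; rewrite /tokens_star swapped_tokensK // [i]ord1.
have tokens_starK : cancel tokens_star star_tokens.
  move=> [S minS]; apply/val_inj; have /asboolP/minP[o defS] := minS.
  by rewrite /= /tokens_star /= defS swapped_tokensK; case: o {defS}.
exists tokens_star; first by exists star_tokens.
move=> S T; rewrite -(tokens_starK S) -(tokens_starK T) !star_tokensK.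
rewrite /= /TJ_adj /= !card_swapped_tokensD !card_swapped_cliqueD.
case: (tokens_star S) (tokens_star T) => i [] j //=.
by do 2!case: ifP.
Qed.
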